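(* Let $D$ be an integral domain and $\star$ a semistar operation on $D$. Then $$\widetilde{\star}\text{-}\dim(D)\le\widetilde{\star}\text{-}\dim_v(D).$$
   Context: For a domain $D$ with quotient field $K$, $\overline{\mathcal F}(D)$ is the set of nonzero $D$-submodules of $K$ and $f(D)$ the set of nonzero finitely generated $D$-submodules of $K$. A semistar operation on $D$ is a map $\star:\overline{\mathcal F}(D)\to\overline{\mathcal F}(D)$, $E\mapsto E^\star$, such that for all $0\ne x\in K$ and $E,F\in\overline{\mathcal F}(D)$: $(xE)^\star=xE^\star$; $E\subseteq F$ implies $E^\star\subseteq F^\star$; $E\subseteq E^\star=(E^\star)^\star$. Define $E^{\star_f}:=\bigcup\{F^\star\mid F\in f(D),F\subseteq E\}$. A nonzero ideal $I$ of $D$ is a quasi-$\star$-ideal if $I^\star\cap D=I$; a quasi-$\star$-prime is a prime quasi-$\star$-ideal; $\operatorname{QMax}^{\star}(D)$ is the set of maximal elements of the set of proper quasi-$\star$-ideals (they are prime). $\widetilde\star$ is the semistar operation $E^{\widetilde\star}:=\bigcap\{ED_P\mid P\in\operatorname{QMax}^{\star_f}(D)\}$ (equal to $K$ if $\operatorname{QMax}^{\star_f}(D)=\emptyset$). $\star\text{-}\dim(D)$ is the supremum of the integers $n$ such that there is a chain $(0)\subsetneq P_1\subsetneq\cdots\subsetneq P_n$ with each $P_i$ a quasi-$\star$-prime of $D$; it is $0$ if there are no quasi-$\star$-primes. A valuation overring $V$ of $D$, i.e. a valuation domain with $D\subseteq V\subseteq K$ ($V=K$ allowed, of dimension $0$),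 is a $\star$-valuation overring if $F^\star\subseteq FV$ for each $F\in f(D)$. $\star\text{-}\dim_v(D)=n$ means every $\star$-valuation overring of $D$ has dimension at most $n$ and some $\star$-valuation overring has dimension $n$; if no such integer exists, $\star\text{-}\dim_v(D)=\infty$. *)

(* Defs.v *)
From HB Require Import structures.
From mathcomp Require Import all_boot all_order all_algebra.
From mathcomp Require Import fraction.
From mathcomp Require Import boolp classical_sets constructive_ereal.

Set Implicit Arguments.
Unset Strict Implicit.
Unset Printing Implicit Defensive.

Import Order.TTheory GRing.Theory Num.Theory.
Local Open Scope classical_set_scope.
Local Open Scope ring_scope.

(* Throughout, the domain D is viewed as a subset of its quotient field K, and
   D-submodules of K, ideals of D, localizations and overrings are all subsets
   of K.  For an [R : idomainType], K is [{fraction R}] and D is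
   [domain_image R]. *)
Definition domain_image (R : idomainType) : set {fraction R} :=
  range (@tofrac R).
Arguments domain_image : clear implicits.

Section Semistar.
Variables (K : fieldType) (D : set K).

Definition submodule (E : set K) : Prop :=
  [/\ E 0,
      forall x y, E x -> E y -> E (x + y)
    & forall a x, D a -> E x -> E (a * x)].

Definition nz_submodule (E : set K) : Prop :=
  submodule E /\ exists2 x, E x & x != 0.

Definition generated n (g : 'I_n -> K) : set K :=
  [set x | exists2 a : 'I_n -> K,
     forall i, D (a i) & x = \sum_(i < n) a i * g i].

Definition nz_fg_submodule (F : set K) : Prop :=
  nz_submodule F /\ exists n, exists g : 'I_n -> K, F = generated g.

Definition scale (x : K) (E : set K) : set K := [set x * e | e in E].

(* Product of two submodules: finite sums of products. *)
Definition prod_set (E F : set K) : set K :=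
  [set x | exists n, exists e f : 'I_n -> K,
     (forall i, E (e i) /\ F (f i)) /\ x = \sum_(i < n) e i * f i].

(* A map on the nonzero submodules is represented by a map on all subsets of K;
   its values on other subsets are irrelevant: nothing is assumed about them
   and they are never used below. *)
Record semistar (star : set K -> set K) : Prop := Semistar {
  semistar_closed : forall E, nz_submodule E -> nz_submodule (star E);
  semistar_scale : forall x E, x != 0 -> nz_submodule E ->
    star (scale x E) = scale x (star E);
  semistar_mono : forall E F, nz_submodule E -> nz_submodule F ->
    E `<=` F -> star E `<=` star F;
  semistar_ext : forall E, nz_submodule E -> E `<=` star E;
  semistar_idem : forall E, nz_submodule E -> star (star E) = star E }.

Definition star_f (star : set K -> set K) (E : set K) : set K :=
  \bigcup_(F in [set F | nz_fg_submodule F /\ F `<=` E]) star F.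

Definition ideal (I : set K) : Prop := submodule I /\ I `<=` D.

Definition prime_ideal (P : set K) : Prop :=
  [/\ ideal P, P != D
    & forall x y, D x -> D y -> P (x * y) -> P x \/ P y].

Definition quasi_ideal (star : set K -> set K) (I : set K) : Prop :=
  [/\ ideal I, exists2 x, I x & x != 0 & star I `&` D = I].

Definition quasi_prime (star : set K -> set K) (P : set K) : Prop :=
  quasi_ideal star P /\ prime_ideal P.

Definition QMax (star : set K -> set K) : set (set K) :=
  [set M | [/\ quasi_ideal star M, M != D
    & forall I, quasi_ideal star I -> I != D -> M `<=` I -> I = M]].

Definition localization (P : set K) : set K :=
  [set x | exists a s, [/\ D a, D s, ~ P s & x = a / s]].

(* When the index set is empty the intersection is the whole of K. *)
Definition star_tilde (star : set K -> set K) (E : set K) : set K :=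
  \bigcap_(P in QMax (star_f star)) prod_set E (localization P).

(* Dimensions are values in [\bar int], to account for infinite ones. *)

(* The chains (0) < P_1 < ... < P_n of quasi-star-primes, with P_0 = (0);
   n = 0 is always allowed, whence the value 0 without quasi-star-primes. *)
Definition star_chain (star : set K -> set K) (n : nat) : Prop :=
  exists P : nat -> set K,
    [/\ P 0%N = [set 0],
        forall i, (i < n)%N -> quasi_prime star (P i.+1)
      & forall i, (i < n)%N -> P i `<` P i.+1].

Definition star_dim (star : set K -> set K) : \bar int :=
  supremum 0%E [set (n%:Z)%:E | n in [set n | star_chain star n]].

End Semistar.

Section Valuation.
Variable K : fieldType.

Definition prime_chain (V : set K) (n : nat) : Prop :=
  exists P : nat -> set K,
    (forall i, (i <= n)%N -> prime_ideal V (P i)) /\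
    (forall i, (i < n)%N -> P i `<` P i.+1).

Definition krull_dim (V : set K) : \bar int :=
  supremum 0%E [set (n%:Z)%:E | n in [set n | prime_chain V n]].

Variable D : set K.

(* An overring of D has quotient field K, so the valuation condition is tested
   on all nonzero elements of K. *)
Record valuation_overring (V : set K) : Prop := ValuationOverring {
  valuation_overring_sub : D `<=` V;
  valuation_overringB : forall x y, V x -> V y -> V (x - y);
  valuation_overringM : forall x y, V x -> V y -> V (x * y);
  valuation_overringV : forall x, x != 0 -> V x \/ V x^-1 }.

Definition star_valuation_overring (star : set K -> set K) (V : set K) : Prop :=
  valuation_overring V /\
  forall F, nz_fg_submodule D F -> star F `<=` prod_set F V.

Definition star_dimv_eq (star : set K -> set K) (n : nat) : Prop :=
  (forall V, star_valuation_overring star V -> (krull_dim V <= (n%:Z)%:E)%E) /\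
  (exists2 V, star_valuation_overring star V & krull_dim V = (n%:Z)%:E).

(* The n with [star_dimv_eq star n] if it exists (it is then unique), and
   infinity otherwise. *)
Definition star_dimv (star : set K -> set K) : \bar int :=
  xget +oo%E [set (n%:Z)%:E | n in star_dimv_eq star].

End Valuation.

(* Main.v *)
(** If [P] is a quasi-prime for the spectral operation, then [1] lies outside
    [P D_Q] for some maximal quasi-ideal [Q], which forces [P <= Q]. Hence any
    valuation overring [V] centered on [P] contains [D_P], so also [D_Q], and is
    a valuation overring for the operation. It remains to lift a chain of primes
    [P_0 < ... < P_n] of [D] to primes of one [V] centered on [P_n]. Chevalley's
    extension theorem gives [V_0] centered on [P_0]; given [V_i] centered on
    [P_i], a valuation ring dominating the subring [D + m_i] at the prime
    [P_{i+1} + m_i] lies inside [V_i] and keeps all primes of [V_i] as primes. *)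
Require Import Defs.
From mathcomp Require Import all_boot all_order all_algebra ring.
From mathcomp Require Import fraction boolp classical_sets constructive_ereal.

Set Implicit Arguments.
Unset Strict Implicit.
Unset Printing Implicit Defensive.

Import Order.TTheory GRing.Theory Num.Theory.
Local Open Scope classical_set_scope.
Local Open Scope ring_scope.

(** * Subrings of a field and polynomial expressions in one element *)

Record subring (K : fieldType) (A : set K) : Prop := Subring {
  subring1 : A 1;
  subringB : forall x y, A x -> A y -> A (x - y);
  subringM : forall x y, A x -> A y -> A (x * y) }.

(** For a valuation ring this is the maximal ideal. Zero is listed apart because [0^-1] is [0],
    which lies in [V]. *)
Definition nonunits (K : fieldType) (V : set K) : set K :=
  [set x | x = 0 \/ ~ V x^-1].

Definition coefs_in (K : fieldType) (J : set K) (p : {poly K}) : Prop :=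
  forall i, J p`_i.

(** For a subring this is the ring [J[y]]; for an ideal [J] of a subring [B] it is the ideal
    generated by [J] in [B[y]]. *)
Definition adjoin (K : fieldType) (J : set K) (y : K) : set K :=
  [set p.[y] | p in coefs_in J].

Section Additive.
Variables (K : fieldType) (J : set K).
Hypotheses (J0 : J 0) (JB : forall x y, J x -> J y -> J (x - y)).

Lemma closedD x y : J x -> J y -> J (x + y).
Proof.
by move=> Jx Jy; rewrite -[y]opprK -[- y]sub0r; apply: JB => //; apply: JB.
Qed.

Lemma closed_sum n (f : 'I_n -> K) : (forall i, J (f i)) -> J (\sum_i f i).
Proof. by move=> Jf; apply: (big_ind J) => //; apply: closedD. Qed.

Lemma adjoinB y u v : adjoin J y u -> adjoin J y v -> adjoin J y (u - v).
Proof.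
move=> [p Jp <-] [q Jq <-]; exists (p - q); last by rewrite hornerD hornerN.
by move=> i; rewrite coefB; apply: JB.
Qed.

Lemma subset_adjoin y : J `<=` adjoin J y.
Proof.
move=> c Jc; exists c%:P; last by rewrite hornerC.
by move=> i; rewrite coefC; case: ifP.
Qed.

(** Separate coefficient sets let one computation show both that [adjoin B y] is a ring and that
    [adjoin J y] is an ideal of it. *)
Lemma adjoinM (B : set K) y u v : (forall b c, B b -> J c -> J (b * c)) ->
  adjoin B y u -> adjoin J y v -> adjoin J y (u * v).
Proof.
move=> BJ [p Bp <-] [q Jq <-]; exists (p * q); last by rewrite hornerM.
by move=> i; rewrite coefM; apply: closed_sum => j; apply: BJ.
Qed.

End Additive.

Lemma adjoin_gen (K : fieldType) (B : set K) y : subring B -> adjoin B y y.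
Proof.
move=> [B1 BB _]; exists 'X; last by rewrite hornerX.
by move=> i; rewrite coefX; case: eqP => // _; have := BB _ _ B1 B1; rewrite subrr.
Qed.

Lemma subring_adjoin (K : fieldType) (B : set K) y :
  subring B -> subring (adjoin B y).
Proof.
move=> [B1 BB BM]; have B0 : B 0 by rewrite -(subrr 1); apply: BB.
split; [exact: subset_adjoin | exact: adjoinB | move=> u v].
exact: adjoinM.
Qed.

Lemma prime_ideal1 (K : fieldType) (A P : set K) :
  prime_ideal A P -> ~ P 1.
Proof.
move=> [[[_ _ PM] PA] PnA _] P1; case/eqP: PnA; apply/seteqP; split=> // x Ax.
by rewrite -[x]mulr1; apply: PM.
Qed.

Lemma prime_idealX (K : fieldType) (A P : set K) s n : subring A ->
  prime_ideal A P -> A s -> ~ P s -> A (s ^+ n) /\ ~ P (s ^+ n).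
Proof.
move=> [A1 _ AM] prP As Ps; elim: n => [|n [An Pn]].
  by rewrite expr0; split=> //; apply: prime_ideal1 prP.
rewrite exprS; split; first exact: AM.
by case: prP => _ _ prP /prP[].
Qed.

(** * Chevalley's extension theorem *)

Section Chevalley.
Variables (K : fieldType) (A P : set K).
Hypotheses (subA : subring A) (prP : prime_ideal A P).

(* Pairs [(J, B)] of an overring [B] and an ideal [J] of [B] with [J] over [P];
   a maximal one is a valuation ring with its maximal ideal. *)
Record above (BJ : set K * set K) : Prop := Above {
  above_ring : subring BJ.2;
  above_sub : A `<=` BJ.2;
  above_prime : P `<=` BJ.1;
  above_ideal : BJ.1 `<=` BJ.2;
  aboveB : forall x y, BJ.1 x -> BJ.1 y -> BJ.1 (x - y);
  aboveM : forall b x, BJ.2 b -> BJ.1 x -> BJ.1 (b * x);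
  above_cap : forall s, A s -> BJ.1 s -> P s }.

Let A0 : A 0. Proof. by rewrite -(subrr 1); case: subA => A1 AB _; apply: AB. Qed.
Let P0 : P 0. Proof. by case: prP => [[[]]]. Qed.

Lemma above_base : above (P, A).
Proof.
case: (prP) => [[[_ PD PM] PA] _ _]; case: (subA) => [A1 AB AM]; split=> //=.
move=> x y Px Py; apply: PD => //; rewrite -mulN1r; apply: PM => //.
by rewrite -sub0r; apply: AB.
Qed.

Definition pair_le (p q : set K * set K) : Prop := p.1 `<=` q.1 /\ p.2 `<=` q.2.

Lemma above_maximal : exists BJ, above BJ /\
  forall CI, above CI -> pair_le BJ CI -> pair_le CI BJ.
Proof.
pose T := {BJ | above BJ}.
pose R (p q : T) := `[< pair_le (sval p) (sval q) >].
have [|p q r /asboolP[pq1 pq2] /asboolP[qr1 qr2]||[BJ aBJ] maxBJ] :=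
    @ZL_preorder T (exist _ _ above_base) R.
- by move=> p; apply/asboolP; split.
- by apply/asboolP; split; [apply: subset_trans qr1|apply: subset_trans qr2].
- move=> F totF.
  (* The empty chain is bounded by [(P, A)], a nonempty one by its componentwise union. *)
  have [->|/set0P[p0 Fp0]] := eqVneq F set0.
    by exists (exist _ _ above_base).
  pose J := \bigcup_(p in F) (sval p).1; pose B := \bigcup_(p in F) (sval p).2.
  have dir p q : F p -> F q ->
      exists r, [/\ F r, pair_le (sval p) (sval r) & pair_le (sval q) (sval r)].
    move=> Fp Fq; have [/asboolP pq|/asboolP qp] := totF _ _ Fp Fq.
      by exists q; split=> //; split.
    by exists p; split=> //; split.
  have aU : above (J, B).
    split=> /=.
    + split.
      * by exists p0 => //; case: (svalP p0) => -[].
      * move=> x y [p Fp px] [q Fq qy]; have [r [Fr pr qr]] := dir _ _ Fp Fq.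
        exists r => //; case: (svalP r) => -[_ rB _] *; apply: rB; first exact: pr.2.
        exact: qr.2.
      * move=> x y [p Fp px] [q Fq qy]; have [r [Fr pr qr]] := dir _ _ Fp Fq.
        exists r => //; case: (svalP r) => -[_ _ rM] *; apply: rM; first exact: pr.2.
        exact: qr.2.
    + by move=> x Ax; exists p0 => //; apply: above_sub (svalP p0) _ Ax.
    + by move=> x Px; exists p0 => //; apply: above_prime (svalP p0) _ Px.
    + by move=> x [p Fp px]; exists p => //; apply: above_ideal (svalP p) _ px.
    + move=> x y [p Fp px] [q Fq qy]; have [r [Fr pr qr]] := dir _ _ Fp Fq.
      exists r => //; apply: (aboveB (svalP r)); first exact: pr.1.
      exact: qr.1.
    + move=> x y [p Fp px] [q Fq qy]; have [r [Fr pr qr]] := dir _ _ Fp Fq.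
      exists r => //; apply: (aboveM (svalP r)); first exact: pr.2.
      exact: qr.1.
    + by move=> s As [p Fp ps]; apply: above_cap (svalP p) _ As ps.
  exists (exist _ _ aU) => p Fp; apply/asboolP.
  by split=> x px; exists p.
exists BJ; split=> // CI aCI le_BC.
by apply/asboolP; apply: (maxBJ (exist _ _ aCI)); apply/asboolP.
Qed.

(** * Properties of a maximal pair *)

Section Maximal.
Variables (J B : set K).
Hypotheses (aBJ : above (J, B))
  (maxBJ : forall CI, above CI -> pair_le (J, B) CI -> pair_le CI (J, B)).

Let subB : subring B. Proof. exact: above_ring aBJ. Qed.
Let J0 : J 0. Proof. exact: (above_prime aBJ). Qed.
Let JB x y : J x -> J y -> J (x - y). Proof. exact: (aboveB aBJ). Qed.
Let JM b x : B b -> J x -> J (b * x). Proof. exact: (aboveM aBJ). Qed.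
Let JD x y : J x -> J y -> J (x + y). Proof. exact: closedD. Qed.
Let AB : A `<=` B. Proof. exact: (above_sub aBJ). Qed.
Let JsubB : J `<=` B. Proof. exact: (above_ideal aBJ). Qed.
Let B0 : B 0. Proof. exact: AB. Qed.
Let BD x y : B x -> B y -> B (x + y).
Proof. by case: subB => _ BB _; apply: closedD. Qed.

(** Otherwise [(J[y], B[y])] would again lie above [P], and maximality would put [y] in [B]. *)
Lemma max_adjoin y : ~ B y -> exists s, [/\ A s, ~ P s & adjoin J y s].
Proof.
move=> nBy; apply: contrapT => no_s; apply: nBy.
have [] : pair_le (adjoin J y, adjoin B y) (J, B); last first.
  by move=> _; apply; apply: adjoin_gen.
apply: maxBJ; last by split; apply: subset_adjoin.
split=> /=.
- exact: subring_adjoin.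
- by move=> x Ax; apply: subset_adjoin => //; apply: AB.
- by move=> x Px; apply: subset_adjoin => //; apply: (above_prime aBJ).
- by move=> _ [p Jp <-]; exists p => // i; apply: JsubB.
- exact: adjoinB.
- by move=> b x; apply: adjoinM.
- by move=> s As Js; apply: contrapT => nPs; apply: no_s; exists s.
Qed.

(** If [u = s + j] had no inverse in [B], some [t] in [A] outside [P] would be a polynomial in
    [u^-1] over [J]. Clearing denominators puts [t * u ^+ N] in [J]; since [u] and [s] agree modulo
    [J], also [t * s ^+ N] is in [J], hence in the prime [P], which is absurd. *)
Lemma max_unit s j : A s -> ~ P s -> J j -> B (s + j)^-1.
Proof.
move=> As Ps Jj; set u := s + j; apply: contrapT => /max_adjoin[t [At Pt [p Jp pt]]].
have u0 : u != 0.
  apply/eqP => u0; apply: Ps; apply: (above_cap aBJ) => //=.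
  by rewrite -(addrK j s) -/u u0; apply: JB.
have Bu n : B (u ^+ n).
  elim: n => [|n IHn]; first by rewrite expr0; case: subB.
  rewrite exprS; case: subB => _ _ BM; apply: BM => //.
  by apply: BD; [apply: AB|apply: JsubB].
have [Asn Psn] := prime_idealX (size p) subA prP As Ps.
have Jdiff n : J (u ^+ n - s ^+ n).
  elim: n => [|n IHn]; first by rewrite !expr0 subrr.
  have -> : u ^+ n.+1 - s ^+ n.+1 = s * (u ^+ n - s ^+ n) + u ^+ n * j.
    by rewrite !exprS /u; ring.
  by apply: JD; apply: JM => //; apply: AB.
have Jtu : J (t * u ^+ size p).
  rewrite -pt horner_coef mulr_suml; apply: closed_sum => // i.
  rewrite exprVn -mulrA mulrC; apply: JM => //.
  have -> : u ^+ size p = u ^+ (size p - i) * u ^+ i by rewrite -exprD subnK // ltnW.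
  by rewrite mulrC mulfK ?expf_neq0.
have : P (t * s ^+ size p).
  apply: (above_cap aBJ) => /=; first by case: subA => _ _; apply.
  rewrite -[_ * _](subKr (t * u ^+ size p)) -mulrBr.
  by apply: JB => //; apply: JM => //; apply: AB.
by case: prP => _ _ pr /pr[].
Qed.

Lemma max_proper : ~ J 1.
Proof.
move=> /(above_cap aBJ); case: subA => A1 _ _ /(_ A1).
exact: prime_ideal1 prP.
Qed.

(* If both [x] and [x^-1] satisfy a relation [1 = \sum_i a_i x^i] over [J], the
   relation of higher degree has its leading term rewritten by the other one. *)
Lemma no_relations n m x p q : x != 0 ->
  coefs_in J p -> (size p <= n.+1)%N -> p.[x] = 1 ->
  coefs_in J q -> (size q <= m.+1)%N -> q.[x^-1] = 1 -> False.
Proof.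
move Dk : (n + m)%N => k.
elim: k => [|k IHk] in n m x p q Dk * => x0 Jp szp px Jq szq qx.
  apply: max_proper; rewrite -px (horner_coef_wide _ szp).
  have -> : n = 0%N by case: n Dk {szp}.
  by rewrite big_ord1 expr0 mulr1.
wlog le_mn : n m x p q Dk x0 Jp szp px Jq szq qx / (m <= n)%N.
  case: (leqP m n) => [le_mn|/ltnW le_nm] hwlog.
    exact: (hwlog n m x p q).
  by apply: (hwlog m n x^-1 q p) => //; rewrite ?invr_eq0 ?invrK // addnC.
have szqn : (size q <= n.+1)%N by apply: leq_trans szq _.
(* As [m <= n], the case [n = 0] would force [n + m = 0]. *)
case: n => [|n] in Dk szp le_mn szqn *; first by case: m Dk le_mn {szq}.
(* [1 - q_0] is a unit of [B], because [q_0] lies in [J]. *)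
have [u [Bu uE]] : exists u, B u /\ u * (1 - q`_0) = 1.
  exists (1 - q`_0)^-1; split.
    apply: max_unit; [by case: subA | exact: prime_ideal1 prP |].
    by rewrite -sub0r; apply: JB.
  apply: mulVf; apply/eqP => /eqP; rewrite subr_eq0 => /eqP q1.
  by apply: max_proper; rewrite q1.
pose c i := u * q`_i.
have Jc i : J (c i) by apply: JM.
(* Multiplying [q.[x^-1] = 1] by [u * x ^+ n.+1] expresses the top power of [x] by lower ones, with
   coefficients in [J]. *)
have xn : x ^+ n.+1 = \sum_(i < n.+1) c (n.+1 - i)%N * x ^+ i.
  have q1 : 1 - q`_0 = \sum_(i < n.+1) q`_i.+1 * x^-1 ^+ i.+1.
    by rewrite -{1}qx (horner_coef_wide _ szqn) big_ord_recl expr0 mulr1 addrC addKr.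
  rewrite -[LHS]mul1r -uE q1 mulr_sumr mulr_suml (reindex_inj rev_ord_inj) /=.
  apply: eq_bigr => i _; rewrite subSS -subSn; last by rewrite -ltnS.
  have -> : x ^+ n.+1 = x ^+ (n.+1 - i) * x ^+ i.
    by rewrite -exprD subnK // ltnW.
  by rewrite /c exprVn -!mulrA mulKf // expf_neq0.
(* Substituting for the top power in [p] lowers its degree bound, so [n + m] drops by one. *)
pose p' := \poly_(i < n.+1) (p`_i + p`_n.+1 * c (n.+1 - i)%N).
apply: (IHk n m x p' q) => //.
- by case: Dk.
- move=> i; rewrite coef_poly; case: ifP => // _; apply: JD => //.
  by apply: JM => //; apply: JsubB.
- exact: size_poly.
- rewrite horner_poly -px (horner_coef_wide _ szp) [RHS]big_ord_recr /= xn mulr_sumr.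
  by rewrite -big_split /=; apply: eq_bigr => i _; rewrite mulrDl -[_ * c _ * _]mulrA.
Qed.


Lemma max_unit1 j : J j -> B (1 + j)^-1.
Proof. by apply: max_unit; [case: subA | exact: prime_ideal1 prP]. Qed.

(** The element [s] given by [max_adjoin] is a unit of [B], so its expression over [J] can be
    divided by it. *)
Lemma max_relation y : ~ B y -> exists2 p, coefs_in J p & p.[y] = 1.
Proof.
move=> /max_adjoin[s [As Ps [p Jp py]]].
have s0 : s != 0 by apply/eqP => s0; apply: Ps; rewrite s0.
have Bs : B s^-1 by rewrite -[s]addr0; apply: max_unit.
exists (s^-1 *: p); last by rewrite hornerZ py mulVf.
by move=> i; rewrite coefZ; apply: JM.
Qed.

Lemma max_valuation : valuation_overring A B.
Proof.
split=> //; [by case: subB | by case: subB | move=> x x0].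
apply: contrapT => /not_orP[/max_relation[p Jp px] /max_relation[q Jq qx]].
exact: (@no_relations (size p) (size q) x p q).
Qed.

(** Elements of [A] outside [P] are units of [B] by [max_unit] with [j = 0]; an element of [P] with
    inverse in [B] would put [1] in [J]. *)
Lemma max_center : nonunits B `&` A = P.
Proof.
apply/seteqP; split=> x.
  move=> [nBx Ax]; apply: contrapT => Px; case: nBx => [x0|].
    by case: Px; rewrite x0.
  by apply; rewrite -[x]addr0; apply: max_unit.
move=> Px; split; last by case: prP => -[_ PA] _ _; apply: PA.
have [|x0] := eqVneq x 0; [by left | right=> Bx; apply: max_proper].
by rewrite -(mulVf x0); apply: JM => //; apply: (above_prime aBJ).
Qed.

End Maximal.

Theorem chevalley_extension :
  exists2 V, valuation_overring A V & nonunits V `&` A = P.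
Proof.
have [[J B] [aBJ maxBJ]] := above_maximal.
by exists B; [exact: max_valuation aBJ maxBJ | exact: max_center aBJ maxBJ].
Qed.

End Chevalley.

(** * The maximal ideal of a valuation ring *)

Section ValuationRing.
Variables (K : fieldType) (D V : set K).
Hypotheses (subD : subring D) (valV : valuation_overring D V).

Lemma valuation_subring : subring V.
Proof.
case: valV => DV VB VM _; split=> //.
by apply: DV; case: subD.
Qed.

Lemma nonunits_prime : prime_ideal V (nonunits V).
Proof.
have [V1 VB VM] := valuation_subring.
have V0 : V 0 by rewrite -(subrr 1); apply: VB.
have VD x y : V x -> V y -> V (x + y) by apply: closedD.
have Vinv x : nonunits V x -> V x.
  have [->//|x0 [x_0|nVx]] := eqVneq x 0; first by rewrite x_0 eqxx in x0.
  by case: (valuation_overringV valV x0).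
have mM a x : V a -> nonunits V x -> nonunits V (a * x).
  move=> Va [->|nVx]; first by left; rewrite mulr0.
  have [->|a0] := eqVneq a 0; first by left; rewrite mul0r.
  right=> Vax; apply: nVx; rewrite -(mulVKf a0 x^-1) -invfM.
  by apply: VM => //; rewrite mulrC.
(* Sums of nonunits: one of [x / y] and [y / x] lies in [V], and by symmetry it may be taken to be
   the first. *)
have mD x y : y != 0 -> V (x / y) -> nonunits V y -> nonunits V (x + y).
  move=> y0 Vxy my; have -> : x + y = (x / y + 1) * y by rewrite mulrDl divfK ?mul1r.
  by apply: mM => //; apply: VD.
split.
- split=> //; split=> //; first by left.
  move=> x y mx my; have [->|x0] := eqVneq x 0; first by rewrite add0r.
  have [->|y0] := eqVneq y 0; first by rewrite addr0.
  have := valuation_overringV valV (mulf_neq0 x0 (invr_neq0 y0)).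
  rewrite invfM invrK => -[Vxy|Vyx]; first exact: mD.
  by rewrite addrC; apply: mD; rewrite // mulrC.
- apply/eqP => mV; have [] : nonunits V 1 by rewrite mV.
    by move/eqP; rewrite oner_eq0.
  by apply; rewrite invr1.
- move=> x y Vx Vy mxy; apply: contrapT => /not_orP[/not_orP[x0 nVx] /not_orP[y0 nVy]].
  case: mxy => [/eqP|]; first by rewrite mulf_eq0 => /orP[]/eqP.
  by apply; rewrite invfM; apply: VM; exact: contrapT.
Qed.

End ValuationRing.

(** * Refining a valuation ring at a larger prime *)

Section Composite.
Variables (K : fieldType) (D V P : set K).
Hypotheses (subD : subring D) (valV : valuation_overring D V).
Hypotheses (prP : prime_ideal D P) (mVP : nonunits V `&` D `<=` P).

Let D' : set K := [set x | exists2 d, D d & nonunits V (x - d)].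
Let P' : set K := [set x | exists2 p, P p & nonunits V (x - p)].

(* [V'] dominates [D' := D + m_V] at [P + m_V]; it lies inside [V], because an
   element of [V'] outside [V] would have its inverse in [m_V], hence among the
   nonunits of [V']. *)
Lemma valuation_refinement : exists2 V', valuation_overring D V' &
  [/\ V' `<=` V, nonunits V `<=` nonunits V' & nonunits V' `&` D = P].
Proof.
have [[[m0 mD mM] mV] mN1 mpr] := nonunits_prime subD valV.
have [V1 VB VM] := valuation_subring subD valV.
have V0 : V 0 by rewrite -(subrr 1); apply: VB.
have DV := valuation_overring_sub valV.
have [D1 DB DM] := subD.
have [[[P0 PD PM] PsD] PnD Ppr] := prP.
have mN x : nonunits V x -> nonunits V (- x).
  by move=> mx; rewrite -mulN1r; apply: mM => //; rewrite -sub0r; apply: VB.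
have mB x y : nonunits V x -> nonunits V y -> nonunits V (x - y).
  by move=> mx my; apply: mD => //; apply: mN.
have D'V : D' `<=` V.
  by move=> x [d Dd mx]; rewrite -(subrK d x); apply: closedD => //; [apply: mV|apply: DV].
have mixM x y a b : V a -> V y -> nonunits V (x - a) -> nonunits V (y - b) ->
    nonunits V (x * y - a * b).
  move=> Va Vy mx my; have -> : x * y - a * b = y * (x - a) + a * (y - b) by ring.
  by apply: mD; apply: mM.
have subD' : subring D'.
  split.
  - by exists 1; rewrite // subrr.
  - move=> x y [d Dd mx] [e De my]; exists (d - e); first exact: DB.
    have -> : x - y - (d - e) = (x - d) - (y - e) by ring.
    exact: mB.
  - move=> x y [d Dd mx] [e De my]; exists (d * e); first exact: DM.
    by apply: mixM => //; [apply: DV|apply: D'V; exists e].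
(* [P'] contracts to [P]: the difference [x - p] lies in both [D] and the maximal ideal of [V],
   hence in [P] by [mVP]. *)
have P'D x : D x -> P' x -> P x.
  move=> Dx [p Pp mx]; rewrite -(subrK p x); apply: PD => //; apply: mVP.
  by split=> //; apply: DB => //; apply: PsD.
have prP' : prime_ideal D' P'.
  split.
  - split; last by move=> x [p Pp mx]; exists p => //; apply: PsD.
    split; first by exists 0; rewrite // subrr.
    + move=> x y [p Pp mx] [q Pq my]; exists (p + q); first exact: PD.
      have -> : x + y - (p + q) = (x - p) + (y - q) by ring.
      exact: mD.
    + move=> a x D'a [p Pp mx]; have [d Dd ma] := D'a.
      exists (d * p); first exact: PM.
      apply: mixM => //; first exact: DV.
      by apply: D'V; exists p => //; apply: PsD.
  - apply/eqP => P'D'; apply: (prime_ideal1 prP); apply: P'D => //.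
    by rewrite P'D'; case: subD'.
  - move=> x y [d Dd mx] D'y; have [e De my] := D'y; move=> [p Pp mxy].
    have : P (d * e).
      apply: P'D; [exact: DM | exists p => //].
      have -> : d * e - p = (x * y - p) - (x * y - d * e) by ring.
      by apply: mB => //; apply: mixM => //; [apply: DV | apply: D'V].
    by case/Ppr => // [Pd|Pe]; [left; exists d | right; exists e].
have [V' valV' cV'] := chevalley_extension subD' prP'.
have DD' : D `<=` D' by move=> d Dd; exists d; rewrite // subrr.
have mP' : nonunits V `<=` P' by move=> x mx; exists 0; rewrite // subr0.
have mm' : nonunits V `<=` nonunits V' by move=> x /mP'; rewrite -cV' => -[].
exists V'.
  by case: valV' => D'V' *; split=> //; apply: subset_trans D'V'.
split=> //.
  move=> x V'x; apply: contrapT => nVx.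
  have /mm'[/eqP|] : nonunits V x^-1 by right; rewrite invrK.
    by rewrite invr_eq0 => /eqP x0; apply: nVx; rewrite x0.
  by rewrite invrK.
apply/seteqP; split=> x.
  by move=> [mx Dx]; apply: P'D => //; rewrite -cV'; split=> //; apply: DD'.
move=> Px; have : P' x by exists x; rewrite // subrr.
by rewrite -cV' => -[mx _]; split=> //; apply: PsD.
Qed.

End Composite.

(** * Lifting a chain of primes to one valuation ring *)

Lemma chain_sub_last (T : Type) (Q : nat -> set T) n :
  (forall i, (i < n)%N -> Q i `<` Q i.+1) ->
  forall i, (i <= n)%N -> Q i `<=` Q n.
Proof.
elim: n => [|n IHn] ltQ i; first by rewrite leqn0 => /eqP->.
rewrite leq_eqVlt => /orP[/eqP-> //|]; rewrite ltnS => le_in.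
apply: subset_trans (properW (ltQ _ (ltnSn n))).
by apply: IHn => // j ltj; apply: ltQ; apply: leqW.
Qed.

Lemma prime_chain_lift (K : fieldType) (D : set K) (P : nat -> set K) n :
  subring D -> (forall i, (i <= n)%N -> prime_ideal D (P i)) ->
  (forall i, (i < n)%N -> P i `<` P i.+1) ->
  exists2 V, valuation_overring D V &
    nonunits V `&` D = P n /\ prime_chain V n.
Proof.
move=> subD prP ltP.
(* The induction also records that the lifted chain ends at the maximal ideal, so that the next
   maximal ideal can be appended above it. *)
suff [V [valV cV [Q [Qn prQ ltQ]]]] : exists V, [/\ valuation_overring D V,
    nonunits V `&` D = P n & exists Q, [/\ Q n = nonunits V,
      forall i, (i <= n)%N -> prime_ideal V (Q i) &
      forall i, (i < n)%N -> Q i `<` Q i.+1]].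
  by exists V => //; split=> //; exists Q.
elim: n => [|n IHn] in prP ltP *.
  have [V valV cV] := chevalley_extension subD (prP _ (leqnn 0)).
  exists V; split=> //; exists (fun=> nonunits V); split=> // i _.
  exact: nonunits_prime valV.
have [|i lt_in|V [valV cV [Q [Qn prQ ltQ]]]] := IHn.
- by move=> i le_in; apply: prP; apply: leqW.
- by apply: ltP; apply: leqW.
have [ltn1 nltn] := ltP n (ltnSn n).
have [|V' valV' [V'V mm' cV']] := valuation_refinement subD valV (prP _ (leqnn n.+1)).
  by rewrite cV.
have QnV i : (i <= n)%N -> Q i `<=` nonunits V.
  by rewrite -Qn; apply: chain_sub_last.
exists V'; split=> //.
(* The old primes lie in the maximal ideal of [V], hence in [V'], and stay prime there because [V']
   is contained in [V]. *)
exists (fun i => if (i <= n)%N then Q i else nonunits V'); split.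
- by rewrite ltnn.
- move=> i _; case: ifP => le_in; last exact: nonunits_prime valV'.
  have prQi := prQ i le_in; have [[[Q0 QD QM] _] _ Qpr] := prQi; split.
  + split; last first.
      move=> x /(QnV _ le_in) /mm' mx.
      by have [[_ mV'] _ _] := nonunits_prime subD valV'; apply: mV'.
    by split=> // a x /V'V Va; apply: QM.
  + apply/eqP => QV'; apply: (prime_ideal1 prQi); rewrite QV'.
    by case: (valuation_subring subD valV').
  + by move=> x y /V'V Vx /V'V Vy; apply: Qpr.
- move=> i; rewrite ltnS => le_in; rewrite le_in.
  have [lt_in|ge_in] := ltnP i n; first exact: ltQ.
  have -> : i = n by apply/eqP; rewrite eqn_leq le_in.
  (* Equal maximal ideals would have equal contractions to [D], against the strictness of [P n] in
     [P n.+1]. *)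
  rewrite Qn; split=> // m'm; apply: nltn => x Px.
  by rewrite -cV; move: Px; rewrite -cV' => -[/m'm mx Dx].
Qed.

(** * Suprema of sets of naturals in [\bar int] *)

(** [supremum] is meaningful only where a least upper bound exists: here it is the maximum if the
    set is bounded, and [+oo] otherwise. *)
Lemma supremums_nat_nonempty (S : set nat) : S !=set0 ->
  supremums [set (n%:Z)%:E | n in S] !=set0.
Proof.
move=> [n0 Sn0]; pose p n := `[< S n >].
have [[N ubN]|unb] := pselect (exists N, forall n, S n -> (n <= N)%N).
  have exp : exists n, p n by exists n0; apply/asboolP.
  have ubp n : p n -> (n <= N)%N by move/asboolP/ubN.
  case: (ex_maxnP exp ubp) => m /asboolP Sm maxm; exists (m%:Z)%:E; split.
    by move=> _ [n Sn <-]; rewrite lee_fin lez_nat; apply: maxm; apply/asboolP.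
  by move=> x; apply; exists m.
exists +oo%E; split; first by move=> _ [n _ <-]; rewrite leey.
move=> [z|//|] ub.
- case: unb; exists `|z|%N => n Sn.
  have : ((n%:Z)%:E <= z%:E)%E by apply: ub; exists n.
  by rewrite lee_fin -lez_nat => /le_trans; apply; rewrite abszE ler_norm.
- by have : ((n0%:Z)%:E <= -oo)%E by apply: ub; exists n0.
Qed.

Lemma supremum_nat (S : set nat) : S !=set0 ->
  supremums [set (n%:Z)%:E | n in S] (supremum 0%E [set (n%:Z)%:E | n in S]).
Proof.
move=> S0; rewrite /supremum ifF; last first.
  by apply/negbTE/set0P; case: S0 => n Sn; exists (n%:Z)%:E; exists n.
by case: (supremums_nat_nonempty S0) => x; apply: xgetI.
Qed.

(** * Quasi-primes, their valuation overrings and the inequality *)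

Lemma subring_domain_image (R : idomainType) : subring (domain_image R).
Proof.
split.
- by exists 1; rewrite // rmorph1.
- by move=> _ _ [a _ <-] [b _ <-]; exists (a - b); rewrite // rmorphB.
- by move=> _ _ [a _ <-] [b _ <-]; exists (a * b); rewrite // rmorphM.
Qed.

Lemma quasi_prime_sub_QMax (K : fieldType) (D : set K) star P :
  subring D -> quasi_prime D (star_tilde D star) P ->
  exists2 Q, QMax D (star_f D star) Q & P `<=` Q.
Proof.
move=> [D1 _ _] [[_ _ sP] prP]; apply: contrapT => noQ.
apply: (prime_ideal1 prP); rewrite -sP; split=> // Q QQ.
(* An [x] in [P] outside [Q] gives [1 = x * x^-1] in [P D_Q]. If there is no [Q] at all, [1] is in
   the empty intersection, so that case is refuted too. *)
have /existsNP[x /not_implyP[Px nQx]] : ~ P `<=` Q by move=> PQ; apply: noQ; exists Q.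
have Q0 : Q 0 by case: QQ => -[[[]]].
have x0 : x != 0 by apply/eqP => x0; apply: nQx; rewrite x0.
exists 1%N, (fun=> x), (fun=> x^-1); rewrite big_ord1 mulfV //; split=> // i.
split=> //; exists 1, x; split=> //; last by rewrite mul1r.
by case: prP => -[_ PD] _ _; apply: PD.
Qed.

(** A denominator outside [Q] is outside [P], the center of [V], so it is a unit of [V]; thus
    [F D_Q] is contained in [F V]. *)
Lemma star_tilde_valuation (K : fieldType) (D : set K) star P V :
  subring D -> quasi_prime D (star_tilde D star) P ->
  valuation_overring D V -> nonunits V `&` D = P ->
  star_valuation_overring D (star_tilde D star) V.
Proof.
move=> subD qP valV cV; split=> // F _ x.
have [Q QQ PQ] := quasi_prime_sub_QMax subD qP.
move=> /(_ Q QQ)[n [e [f [ef ->]]]]; exists n, e, f; split=> // i.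
have [Fe [a [s [Da Ds Qs ->]]]] := ef i; split=> //.
have VM := valuation_overringM valV; have DV := valuation_overring_sub valV.
apply: VM; first exact: DV.
by apply: contrapT => nVs; apply: Qs; apply: PQ; rewrite -cV; split=> //; right.
Qed.

Theorem mainTheorem11 (R : idomainType)
    (star : set {fraction R} -> set {fraction R})
    (hstar : semistar (domain_image R) star) :
  (star_dim (domain_image R) (star_tilde (domain_image R) star)
   <= star_dimv (domain_image R) (star_tilde (domain_image R) star))%E.
Proof.
have subD := subring_domain_image R.
rewrite /star_dimv; case: xgetP => [_ _ [n [le_dim _] <-]|_]; last exact: leey.
have [|_] := @supremum_nat
    [set m | star_chain (domain_image R) (star_tilde (domain_image R) star) m].
  by exists 0%N, (fun=> [set 0]).
apply=> _ [m [P [P0 qP ltP]] <-].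
(* A chain of length 0 has no quasi-prime on which to center a valuation ring; the bound is then
   [0 <= n]. *)
case: m => [|m] in qP ltP *; first by rewrite lee_fin lez_nat.
(* The zero ideal at index 0 is prime as well, so the chain lifts to [m.+2] primes, that is to a
   [prime_chain] of length [m.+1]. *)
have prP i : (i <= m.+1)%N -> prime_ideal (domain_image R) (P i).
  case: i => [|i] lt_im; last by case: (qP i lt_im).
  have [D1 DB _] := subD; rewrite P0; split.
  - split=> [|_ ->]; last by rewrite -(subrr 1); apply: DB.
    by split=> // [x y -> ->|a x _ ->]; rewrite ?addr0 ?mulr0.
  - by apply/eqP => D0; move: D1; rewrite -D0 => /eqP; rewrite oner_eq0.
  - by move=> x y _ _ /eqP; rewrite mulf_eq0 => /orP[]/eqP; [left|right].
have [V valV [cV chV]] := prime_chain_lift subD prP ltP.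
have starV := star_tilde_valuation subD (qP m (ltnSn m)) valV cV.
apply: le_trans (le_dim V starV).
have [|ub _] := @supremum_nat [set k | prime_chain V k]; first by exists m.+1.
by apply: ub; exists m.+1.
Qed.
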